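(* Let $(\mathfrak{X},\mathcal{A})$ be a measurable space, $H$ a probability measure on it, and $c>0$ a fixed number. For each integer $n\ge1$ let $P_{H,n^2c}\sim\text{N-IGP}(n^2c,H)$ (i.e. the concentration parameter is $a=n^2c$), all defined on a common probability space. Then, for any measurable subset $A\in\mathcal{A}$ of $\mathfrak{X}$, as $n\to\infty$, $$P_{H,n^2c}(A)\overset{a.s.}{\to}H(A).$$
   Context: Normalized inverse-Gaussian distribution: for $m\ge 2$ and $\gamma_1,\dots,\gamma_m>0$, a random vector $(Z_1,\dots,Z_m)$ with values in $\mathbb{S}=\{(z_1,\dots,z_m): z_i\ge 0,\ \sum_{i=1}^m z_i=1\}$ has the normalized inverse-Gaussian distribution $\text{N-IG}(\gamma_1,\dots,\gamma_m)$ if it has density (with respect to Lebesgue measure in $(z_1,\dots,z_{m-1})$, with $z_m=1-\sum_{i<m}z_i$) $$f(z_1,\dots,z_m)=\frac{e^{\sum_{i=1}^m\gamma_i}\prod_{i=1}^m\gamma_i}{2^{m/2-1}\pi^{m/2}}\,K_{-m/2}\!\left(\sqrt{\sum_{i=1}^m\frac{\gamma_i^2}{z_i}}\right)\left(\sum_{i=1}^m\frac{\gamma_i^2}{z_i}\right)^{-m/4}\prod_{i=1}^m z_i^{-3/2}\, I_{\mathbb{S}}(z_1,\dots,z_m),$$ where $K_\nu$ is the modified Bessel function of the third type (also called of the second kind, or Macdonald function). Normalized inverse-Gaussian process: for a probability measure $H$ on $(\mathfrak{X},\mathcal{A})$ and $a>0$, a random probability measure $P_{H,a}$ on $(\mathfrak{X},\mathcal{A})$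 is a normalized inverse-Gaussian process with parameters $a$ and $H$, written $P_{H,a}\sim\text{N-IGP}(a,H)$, if for every finite measurable partition $A_1,\dots,A_m$ of $\mathfrak{X}$ the vector $(P_{H,a}(A_1),\dots,P_{H,a}(A_m))$ has the $\text{N-IG}(aH(A_1),\dots,aH(A_m))$ distribution, with the convention that $P_{H,a}(A_i)=0$ almost surely whenever $H(A_i)=0$. *)

(* Defs.v *)
From HB Require Import structures.
From mathcomp Require Import all_boot all_order all_algebra.
From mathcomp Require Import all_classical all_reals all_analysis.

Set Implicit Arguments.
Unset Strict Implicit.
Unset Printing Implicit Defensive.

Import Order.TTheory GRing.Theory Num.Theory.
Import numFieldNormedType.Exports.

Local Open Scope classical_set_scope.
Local Open Scope ring_scope.

(* MathComp-Analysis.  [R : realType] is the field of real numbers and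
   [measurableTypeR R] is [R] equipped with its Borel sigma-algebra. *)

Section lebesgue_tuple.
Context {R : realType}.
Local Notation RB := (measurableTypeR R).

Definition cons_pair n (p : RB * n.-tuple RB) : n.+1.-tuple RB :=
  [tuple of p.1 :: p.2].

(* Lebesgue measure on R^n, by transporting the product of the Lebesgue measure
   on R and of the Lebesgue measure on R^(n-1); R^0 is given mass 1. *)
Fixpoint lebesgue_tuple (n : nat) : set (n.-tuple RB) -> \bar R :=
  match n with
  | 0 => \d_([tuple] : 0.-tuple RB)
  | n'.+1 => pushforward (@lebesgue_measure R \x @lebesgue_tuple n')%E
               (@cons_pair n')
  end.

Lemma measurable_cons_pair n : measurable_fun setT (@cons_pair n).
Proof. exact: measurable_cons. Qed.

Lemma lebesgue_tuple_subproof n :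
  exists mu : {sigma_finite_measure set (n.-tuple RB) -> \bar R},
    mu = @lebesgue_tuple n :> (set _ -> \bar R).
Proof.
elim: n => [|n [mu muE]]; first by exists (\d_([tuple] : 0.-tuple RB)).
have mc := @measurable_cons_pair n.
pose nu0 : {measure set (n.+1.-tuple RB) -> \bar R} :=
  pushforward (@lebesgue_measure R \x mu)%E (@cons_pair n).
pose nu := nu0 mc.
have nuE : nu = pushforward (@lebesgue_measure R \x mu)%E (@cons_pair n)
  :> (set _ -> \bar R) by [].
have nu_sf : sigma_finite setT nu.
  (* The sigma-finite structure on products of measures is not inferred. *)
  have [F FT mF] : sigma_finite setT (@lebesgue_measure R \x mu)%E.
    have /sigma_finiteP[F [TF ndF Foo]] := sigma_finiteT (@lebesgue_measure R).
    have /sigma_finiteP[G [TG ndG Goo]] := sigma_finiteT mu.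
    exists (fun n => F n `*` G n).
      rewrite -setXTT TF TG predeqE => -[x y]; split.
        move=> [/= [k _ Fkx] [l _ Gly]]; exists (maxn k l) => //; split.
        - by move: x Fkx; exact/subsetPset/ndF/leq_maxl.
        - by move: y Gly; exact/subsetPset/ndG/leq_maxr.
      by move=> [k _ []/= ? ?]; split; exists k.
    move=> k; have [? ?] := Foo k; have [? ?] := Goo k.
    split; first exact: measurableX.
    by rewrite product_measure1E// lte_mul_pinfty// ge0_fin_numE.
  pose u (t : n.+1.-tuple RB) : RB * n.-tuple RB :=
    (thead t, [tuple of behead t]).
  have mu_ : measurable_fun setT u.
    by apply/measurable_fun_pair; [exact: measurable_tnth
                                  |exact: measurable_behead].
  have uK : cancel (@cons_pair n) u.
    by move=> [x t]; congr pair; apply/val_inj.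
  exists (fun i => u @^-1` F i).
    by rewrite -preimage_bigcup -FT preimage_setT.
  move=> i; have [mFi Fi] := mF i; split.
    by rewrite -[X in measurable X]setTI; exact: mu_.
  by rewrite nuE /pushforward -comp_preimage (_ : u \o _ = id)//; exact/funext.
pose sfnu : isSigmaFinite _ _ _ nu := isSigmaFinite.Build _ _ _ nu nu_sf.
pose snu : isSFinite _ _ _ nu :=
  isSFinite.Build _ _ _ nu (sfinite_measure_sigma_finite nu_sf).
pose nu' : {sigma_finite_measure set (n.+1.-tuple RB) -> \bar R} :=
  HB.pack (nu : set _ -> \bar R) (Measure.class nu) snu sfnu.
by exists nu'; rewrite /= -muE.
Qed.

Let lebesgue_tuple0 n : @lebesgue_tuple n set0 = 0%E.
Proof. by have [mu <-] := lebesgue_tuple_subproof n; rewrite measure0. Qed.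

Let lebesgue_tuple_ge0 n A : (0 <= @lebesgue_tuple n A)%E.
Proof. by have [mu <-] := lebesgue_tuple_subproof n; rewrite measure_ge0. Qed.

Let lebesgue_tuple_sigma_additive n : semi_sigma_additive (@lebesgue_tuple n).
Proof.
have [mu <-] := lebesgue_tuple_subproof n.
exact: measure_semi_sigma_additive.
Qed.

HB.instance Definition _ n := isMeasure.Build _ _ _ (@lebesgue_tuple n)
  (@lebesgue_tuple0 n) (@lebesgue_tuple_ge0 n)
  (@lebesgue_tuple_sigma_additive n).

Let lebesgue_tuple_sigma_finite n : sigma_finite setT (@lebesgue_tuple n).
Proof.
by have [mu <-] := lebesgue_tuple_subproof n; exact: sigma_finiteT.
Qed.

HB.instance Definition _ n := Measure_isSigmaFinite.Build _ _ _
  (@lebesgue_tuple n) (@lebesgue_tuple_sigma_finite n).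

End lebesgue_tuple.
Arguments lebesgue_tuple R n : clear implicits.

(* The modified Bessel function of the third kind (Macdonald function),
   K_nu(x) = 1/2 \int_0^oo u^(nu-1) exp(-(x/2)(u + 1/u)) du for 0 < x; this is
   K_nu(x) = \int_0^oo exp(-x cosh t) cosh(nu t) dt after setting u = e^t. *)
Definition besselK {R : realType} (nu x : R) : R :=
  2^-1 * \int[@lebesgue_measure R]_(u in `]0, +oo[)
           (u `^ (nu - 1) * expR (- (x / 2) * (u + u^-1))).

Section normalized_inverse_gaussian.
Context {R : realType}.

Definition simplex {m : nat} : set ('I_m -> R) :=
  [set z | (forall i, 0 <= z i) /\ \sum_(i < m) z i = 1].

Definition nig_density (m : nat) (gamma z : 'I_m -> R) : R :=
  let q := \sum_(i < m) gamma i ^+ 2 / z i in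
  expR (\sum_(i < m) gamma i) * (\prod_(i < m) gamma i)
    / (2 `^ (m%:R / 2 - 1) * pi `^ (m%:R / 2))
  * besselK (- (m%:R / 2)) (Num.sqrt q) * q `^ (- (m%:R / 4))
  * (\prod_(i < m) z i `^ (- (3 / 2))) * \1_simplex z.

(* (z_1, ..., z_{m-1}) |-> (z_1, ..., z_{m-1}, 1 - z_1 - ... - z_{m-1}): the
   only index out of the range of [z] is the last one. *)
Definition simplex_point (m : nat) (z : m.-1.-tuple (measurableTypeR R)) :
    'I_m -> R :=
  fun i => nth (1 - \sum_(j < m.-1) tnth z j) z i.

(* [Z] has the N-IG(gamma_1, ..., gamma_m) distribution under [P].  The density
   refers to the first m-1 coordinates, which determine the last one as [Z]
   lies in the simplex. *)
Definition has_NIG d (Omega : measurableType d) (P : probability Omega R)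
    (m : nat) (gamma : 'I_m -> R) (Z : Omega -> 'I_m -> R) : Prop :=
  [/\ (2 <= m)%N, forall i, 0 < gamma i,
      forall i, measurable_fun setT (fun w => Z w i),
      {ae P, forall w, simplex (Z w)} &
      forall B : set (m.-1.-tuple (measurableTypeR R)), measurable B ->
        P [set w | B [tuple Z w (widen_ord (leq_pred m) i) | i < m.-1]] =
        (\int[lebesgue_tuple R m.-1]_(z in B)
           (nig_density gamma (simplex_point z))%:E)%E].

(* A random probability measure on [X] is a probability kernel from [Omega] to
   [X].  The N-IG distribution is only defined for positive parameters: the
   cells of mass 0 of a partition are almost surely given mass 0, and the other
   cells, when there are at least two of them, are jointly N-IG distributed
   (when there is only one, it almost surely has mass 1). *)
Definition is_NIGP dO (Omega : measurableType dO) (P : probability Omega R)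
    dX (X : measurableType dX) (a : R) (H : probability X R)
    (Q : R.-pker Omega ~> X) : Prop :=
  forall (m : nat) (A : 'I_m -> set X),
    (forall i, measurable (A i)) -> partition setT A setT ->
    let J := [pred i | H (A i) != 0%E] in
    (forall i, i \notin J -> {ae P, forall w, Q w (A i) = 0%E}) /\
    ((2 <= #|J|)%N ->
      has_NIG P (fun k : 'I_#|J| => a * fine (H (A (enum_val k))))
                (fun w k => fine (Q w (A (enum_val k))))).

End normalized_inverse_gaussian.

(* Main.v *)
(* The N-IG density with parameters a g_1, ..., a g_m, where sum_i g_i = 1,
   contains K_nu(a s) with s^2 = sum_i g_i^2 / z_i
   = 1 + sum_i (z_i - g_i)^2 / z_i on the simplex.  Since
   K_nu(a s) <= e^(-(a - c) s) K_nu(c s) for c <= a, the density for a at a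
   point at distance more than e from g is at most
   (a / c)^m e^(-(a - c)(sqrt(1 + e^2) - 1)) times the density for c, which has
   total mass 1.  This bounds P(|Z_i - g_i| > e) without evaluating any Bessel
   function; for a = n^2 c the bound is summable and Borel-Cantelli applies. *)
Require Import Defs.
From HB Require Import structures.
From mathcomp Require Import all_boot all_order all_algebra.
From mathcomp Require Import ring lra.
From mathcomp Require Import all_classical all_reals all_analysis.
From mathcomp Require Import measurable_realfun.

Import Order.TTheory GRing.Theory Num.Theory.
Import numFieldNormedType.Exports.

Local Open Scope classical_set_scope.
Local Open Scope ring_scope.

(** Applying ln t <= t to t = (b / a) v gives a ln v - b v <= - a ln (b / a), so C = (a / b)^a
    works. *)
Lemma powR_expR_bounded {R : realType} (a b : R) : 0 < a -> 0 < b ->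
  exists C, forall v, 0 < v -> v `^ a * expR (- (b * v)) <= C.
Proof.
move=> a0 b0; exists (expR (- (a * ln (b / a)))) => v v0.
have ba0 : 0 < b / a by rewrite divr_gt0.
rewrite /powR (gt_eqF v0) -expRD ler_expR -subr_ge0.
have := ltW (ln_sublinear (mulr_gt0 ba0 v0)).
rewrite (@lnM _ (b / a))// => /(ler_wpM2l (ltW a0)) h.
have -> : - (a * ln (b / a)) - (a * ln v - b * v) =
  a * (b / a * v) - a * (ln (b / a) + ln v) by field; rewrite gt_eqF.
by rewrite subr_ge0.
Qed.

(** * The Macdonald function: measurability, integrability and decay *)

Section besselK.
Context {R : realType}.
Notation mu := (@lebesgue_measure R).
Implicit Types nu x u : R.

Let integrand nu x u := u `^ (nu - 1) * expR (- (x / 2) * (u + u^-1)).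

Let integrandE nu x u : 0 <= u ->
  integrand nu x u = u `^ (nu - 1) * expR (- (x / 2) * (u + u `^ (-1))).
Proof. by move=> u0; rewrite powR_inv1. Qed.

Let integrand_ge0 nu x u : 0 <= integrand nu x u.
Proof. by rewrite mulr_ge0 ?powR_ge0 ?expR_ge0. Qed.

Lemma besselK_ge0 nu x : 0 <= besselK nu x.
Proof.
rewrite /besselK mulr_ge0 ?invr_ge0//.
by apply: Rintegral_ge0 => u _; exact: integrand_ge0.
Qed.

(** By Tonelli: the integrand, cut off by the indicator of ]0, +oo[ and with 1/u written as a real
    power, is nonnegative and jointly measurable in (x, u), so its integral over u is measurable in
    x. *)
Lemma measurable_besselK nu : measurable_fun setT (@besselK R nu).
Proof.
pose f (p : R * R) : R :=
  p.2 `^ (nu - 1) * expR (- (p.1 / 2) * (p.2 + p.2 `^ (-1)))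
    * \1_(`]0, +oo[ : set R) p.2.
have mf : measurable_fun [set: R * R] f.
  apply: measurable_funM; last first.
    by apply: measurableT_comp => //; exact: measurable_indic.
  apply: measurable_funM.
    by apply: (measurableT_comp (measurable_powR _)).
  apply: measurableT_comp => //; apply: measurable_funM.
    by apply: measurableT_comp => //; exact: measurable_funM.
  apply: measurable_funD => //.
  by apply: (measurableT_comp (measurable_powR _)).
 have f0 p : (0 <= (EFin \o f) p)%E.
  by rewrite lee_fin !mulr_ge0 ?powR_ge0 ?expR_ge0.
have mF := measurable_fun_fubini_tonelli_F (m2 := mu) _
  (iffRL (measurable_EFinP _ _) mf) f0.
apply: (eq_measurable_fun
  (fun x => 2^-1 * fine (fubini_F mu (EFin \o f) x))); last first.
  by apply: measurable_funM => //; apply: measurableT_comp mF.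
move=> x _; rewrite /besselK /Rintegral /fubini_F; congr (_ * fine _).
rewrite [RHS]integral_mkcond; apply: eq_integral => u _.
rewrite patchE /f /= indicE; case: ifPn => [|_]; last by rewrite mulr0.
rewrite inE/= in_itv/= andbT => u0.
by rewrite mulr1 powR_inv1 ?ltW.
Qed.

(** Near 0, u^(nu-1) e^(-(x/2)/u) stays bounded: take v = 1/u and the exponent 1 - nu > 0 in
    [powR_expR_bounded]. The remaining factor e^(-(x/2) u) is a multiple of an exponential
    density. *)
Lemma integrable_besselK nu x : nu < 1 -> 0 < x ->
  mu.-integrable `]0, +oo[ (EFin \o integrand nu x).
Proof.
move=> nu1 x0; have x2 : 0 < x / 2 by rewrite divr_gt0.
have [|C hC] := powR_expR_bounded (1 - nu) (x / 2) _ x2.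
  by rewrite subr_gt0.
have /integrableS iE : mu.-integrable setT
    (EFin \o (fun u => C / (x / 2) * exponential_pdf (x / 2) u)).
  exact: (integrableZl measurableT (C / (x / 2))
    (integrable_exponential_pdf x2)).
apply: le_integrable (iE _ _ _ _) => //.
  apply: (eq_measurable_fun (fun u =>
      (u `^ (nu - 1) * expR (- (x / 2) * (u + u `^ (-1))))%:E)).
    move=> u; rewrite inE/= in_itv/= andbT => u0.
    by rewrite -integrandE ?ltW.
  apply/measurable_EFinP; apply: measurable_funTS; apply: measurable_funM.
    exact: measurable_powR.
  apply: measurableT_comp => //; apply: measurable_funM => //.
  apply: measurable_funD => //; exact: measurable_powR.
move=> u /=; rewrite in_itv/= andbT => u0; rewrite lee_fin.
rewrite ger0_norm//; apply: le_trans (ler_norm _).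
rewrite exponential_pdfE ?(ltW u0)//.
rewrite mulrA divfK ?gt_eqF// /integrand mulrDr expRD mulrCA mulrC.
rewrite ler_wpM2r ?expR_ge0//.
have := hC u^-1; rewrite invr_gt0 => /(_ u0).
by rewrite -powR_inv1 ?(ltW u0)// -powRrM mulN1r opprB mulNr.
Qed.

(* [K_nu] decays at least exponentially, as [u + 1/u >= 2] in its integrand. *)
Lemma besselK_scale nu x y : nu < 1 -> 0 < x -> x <= y ->
  besselK nu y <= expR (- (y - x)) * besselK nu x.
Proof.
move=> nu1 x0 xy; rewrite /besselK mulrCA ler_wpM2l//.
rewrite -RintegralZl//; last exact: integrable_besselK.
have iZ : mu.-integrable `]0, +oo[
    (EFin \o (fun u => expR (- (y - x)) * integrand nu x u)).
  exact: (integrableZl _ (expR (- (y - x))) (integrable_besselK nu x nu1 x0)).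
apply: le_Rintegral => //.
  by apply: integrable_besselK => //; exact: lt_le_trans xy.
move=> u /=; rewrite in_itv/= andbT => u0.
rewrite mulrCA ler_wpM2l ?powR_ge0// -expRD ler_expR.
have hu : 2 <= u + u^-1.
  have -> : u + u^-1 = 2 + (u - 1) ^+ 2 / u by field; rewrite gt_eqF.
  by rewrite lerDl divr_ge0 ?sqr_ge0 ?ltW.
set v := u + u^-1 in hu *.
(* Half of this product is the difference of the two exponents to be compared. *)
have : 0 <= (y - x) * (v - 2) by rewrite mulr_ge0 ?subr_ge0.
nra.
Qed.

End besselK.

(** * The N-IG density: measurability and comparison of two concentrations *)

Section nig_density.
Context {R : realType} {m : nat}.
Notation RB := (measurableTypeR R).
Implicit Types (g z : 'I_m -> R).

Lemma measurable_simplex_point (i : 'I_m) :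
  measurable_fun setT (fun z : m.-1.-tuple RB => simplex_point z i : R).
Proof.
have [im|im] := ltnP i m.-1.
  apply: (eq_measurable_fun (fun z : m.-1.-tuple RB => tnth z (Ordinal im))).
    by move=> z _; rewrite /simplex_point (tnth_nth (1 - \sum_j tnth z j)).
  exact: measurable_tnth.
(* Here [i] is the last index, where [nth] returns its default value. *)
apply: (eq_measurable_fun (fun z : m.-1.-tuple RB =>
    1 - \sum_(j < m.-1) (tnth z j : R))).
  by move=> z _; rewrite /simplex_point nth_default ?size_tuple.
apply: measurable_funB => //; apply: measurable_sum => j.
exact: measurable_tnth.
Qed.

Lemma nig_density_ge0 g z : (forall i, 0 <= g i) -> 0 <= nig_density g z.
Proof.
move=> g0; rewrite /nig_density !(besselK_ge0, mulr_ge0) ?powR_ge0//.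
- exact: prodr_ge0.
- by rewrite invr_ge0 mulr_ge0 ?powR_ge0.
- by apply: prodr_ge0 => i _; exact: powR_ge0.
Qed.

Lemma nig_density_out g z : ~ simplex z -> nig_density g z = 0.
Proof. by move=> sz; rewrite /nig_density indicE memNset ?mulr0. Qed.

(** The density equals [f], in which inverses and the square root are real powers and the indicator
    of the simplex is a product of indicators of measurable functions. Off the simplex both vanish;
    on it the coordinates are nonnegative, so the powers agree. *)
Lemma measurable_nig_density g :
  measurable_fun setT (fun z : m.-1.-tuple RB =>
    nig_density g (simplex_point z)).
Proof.
pose q (z : m.-1.-tuple RB) : R :=
  \sum_(i < m) g i ^+ 2 * simplex_point z i `^ (-1).
pose ind (z : m.-1.-tuple RB) : R :=
  (\prod_(i < m) \1_(`[0, +oo[ : set R) (simplex_point z i))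
  * \1_([set 1] : set R) (\sum_(i < m) simplex_point z i).
pose C := expR (\sum_(i < m) g i) * (\prod_(i < m) g i)
    / (2 `^ (m%:R / 2 - 1) * pi `^ (m%:R / 2)).
pose f (z : m.-1.-tuple RB) :=
  C * besselK (- (m%:R / 2)) (q z `^ 2^-1) * q z `^ (- (m%:R / 4))
  * (\prod_(i < m) simplex_point z i `^ (- (3 / 2))) * ind z.
have mq : measurable_fun setT q.
  apply: measurable_sum => i; apply: measurable_funM => //.
  apply: (measurableT_comp (measurable_powR _)).
  exact: measurable_simplex_point.
have mf : measurable_fun setT f.
  apply: measurable_funM.
    apply: measurable_funM.
      apply: measurable_funM.
        apply: measurable_funM => //.
        apply: (measurableT_comp (measurable_besselK _)).
        exact: (measurableT_comp (measurable_powR _)).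
      exact: (measurableT_comp (measurable_powR _)).
    apply: measurable_prod => i _.
    apply: (measurableT_comp (measurable_powR _)).
    exact: measurable_simplex_point.
  apply: measurable_funM.
    apply: measurable_prod => i _.
    apply: measurableT_comp; last exact: measurable_simplex_point.
    exact: measurable_indic.
  apply: measurableT_comp; first exact: measurable_indic.
  by apply: measurable_sum => i; exact: measurable_simplex_point.
apply: eq_measurable_fun mf => z _.
have [sz|sz] := pselect (simplex (simplex_point z)); last first.
  rewrite (nig_density_out _ _ sz) /f.
  suff -> : ind z = 0 by rewrite mulr0.
  rewrite /ind; apply/eqP; rewrite mulf_eq0; apply/orP.
  have [s1|s1] := eqVneq (\sum_(i < m) simplex_point z i) 1; last first.
    by right; rewrite indicE memNset//; exact/eqP.
  left; have [i si] : exists i, ~ 0 <= simplex_point z i.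
    by apply/existsNP => h; apply: sz; split.
  rewrite (bigD1 i)//= indicE memNset ?mul0r//.
  by rewrite /= in_itv/= andbT.
have [z0 z1] := sz.
have qE : q z = \sum_(i < m) g i ^+ 2 / simplex_point z i.
  by apply: eq_bigr => i _; rewrite powR_inv1.
have q0 : 0 <= q z.
  by apply: sumr_ge0 => i _; rewrite mulr_ge0 ?sqr_ge0 ?powR_ge0.
rewrite /f /nig_density -qE powR12_sqrt// indicE mem_set//.
suff -> : ind z = 1 by [].
rewrite /ind z1 indicE mem_set// mulr1 big1// => i _.
by rewrite indicE mem_set//= in_itv/= z0.
Qed.

(* On the simplex, [\sum_i g_i^2 / z_i = 1 + \sum_i (z_i - g_i)^2 / z_i]. *)
Lemma sum_sqr_div_ge g z (e : R) (k : 'I_m) : \sum_i g i = 1 ->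
  \sum_i z i = 1 -> (forall i, 0 < z i) -> 0 < e -> e < `|z k - g k| ->
  1 + e ^+ 2 <= \sum_i g i ^+ 2 / z i.
Proof.
move=> g1 z1 z0 e0 ek.
have -> : \sum_i g i ^+ 2 / z i =
    \sum_i ((z i - g i) ^+ 2 / z i + (g i *+ 2 - z i)).
  by apply: eq_bigr => i _; field; rewrite gt_eqF.
(* The linear terms 2 g_i - z_i sum to 2 - 1 = 1. *)
rewrite big_split/= sumrB sumrMnl g1 z1 mulr2n addrK  [leLHS]addrC lerD2r.
(* Only the k-th square is kept, and z_k <= 1 removes its denominator. *)
rewrite (bigD1 k)//= -[leLHS]addr0 lerD//; last first.
  by apply: sumr_ge0 => i _; rewrite divr_ge0 ?sqr_ge0 ?ltW.
have zk : z k <= 1.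
  by rewrite -z1 (bigD1 k)//= lerDl sumr_ge0// => i _; exact: ltW.
rewrite ler_pdivlMr//; apply: (@le_trans _ _ (e ^+ 2)).
  by rewrite ler_piMr ?sqr_ge0.
by rewrite -[leRHS]real_normK ?num_real// lerXn2r ?nnegrE ?ltW// (lt_trans e0).
Qed.

(** Going from c to a, the product of the parameters gains exactly (a / c)^m, the negative power of
    the quadratic sum can only decrease, and e^b K(b s) loses at least e^(-(a - c)(s - 1)), where s
    >= sqrt(1 + e^2). *)
Lemma nig_density_scale_le g z (c a e : R) (k : 'I_m) :
  (forall i, 0 < g i) -> \sum_i g i = 1 -> 0 < c -> c <= a -> 0 < e ->
  e < `|z k - g k| ->
  nig_density (fun i => a * g i) z <=
  (a / c) ^+ m * expR (- ((a - c) * (Num.sqrt (1 + e ^+ 2) - 1)))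
  * nig_density (fun i => c * g i) z.
Proof.
move=> g0 g1 c0 ca e0 ek; have a0 : 0 < a := lt_le_trans c0 ca.
have [sz|sz] := pselect (simplex z); last first.
  by rewrite !nig_density_out// mulr0.
have [zge0 z1] := sz.
(* At a zero coordinate both densities vanish, because 0 to the power -3/2 is 0 by convention. *)
have [[i zi]|zn0] := pselect (exists i, z i = 0).
  suff E h : nig_density h z = 0 by rewrite !E mulr0.
  rewrite /nig_density [X in _ * X * _](bigD1 i)//= zi.
  by rewrite powR0 ?mul0r ?mulr0 ?mul0r//.
have z0 i : 0 < z i.
  by rewrite lt_neqAle zge0 andbT eq_sym; apply/eqP => zi; apply: zn0; exists i.
pose q := \sum_i g i ^+ 2 / z i.
have q_ge : 1 + e ^+ 2 <= q by exact: sum_sqr_div_ge ek.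
have q0 : 0 < q by apply: lt_le_trans q_ge; rewrite ltr_wpDr ?sqr_ge0.
have qE b : \sum_i (b * g i) ^+ 2 / z i = b ^+ 2 * q.
  by rewrite mulr_sumr; apply: eq_bigr => i _; rewrite exprMn mulrA.
pose s := Num.sqrt q.
have sE b : 0 < b -> Num.sqrt (b ^+ 2 * q) = b * s.
  by move=> b0; rewrite sqrtrM ?sqr_ge0// sqrtr_sqr gtr0_norm.
have pE b : \prod_i (b * g i) = b ^+ m * \prod_i g i.
  by rewrite big_split/= prodr_const card_ord.
set s0 := Num.sqrt (1 + e ^+ 2).
have s0s : s0 <= s by rewrite /s0 /s ler_wsqrtr.
have s_gt0 : 0 < s by rewrite sqrtr_gt0.
rewrite /nig_density !qE !sE// !pE -!mulr_sumr g1 !mulr1 indicE mem_set//.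
rewrite !mulr1.
set nu := - (m%:R / 2).
have nu1 : nu < 1.
  by rewrite (@le_lt_trans _ _ 0)// oppr_le0 divr_ge0.
have hK : expR a * besselK nu (a * s) <=
    expR (- ((a - c) * (s0 - 1))) * (expR c * besselK nu (c * s)).
  have := @besselK_scale R nu (c * s) (a * s) nu1.
  rewrite mulr_gt0// ler_pM2r// => /(_ isT ca) h.
  have := ler_wpM2l (expR_ge0 a) h.
  move: (besselK nu (a * s)) (besselK nu (c * s)) (besselK_ge0 nu (c * s)).
  move=> Ka Kc Kc0 /le_trans; apply.
  rewrite !mulrA -!expRD ler_wpM2r// ler_expR.
  (* The exponents are a - (a - c) s on the left and a - (a - c) s0 on the right. *)
  have : 0 <= (a - c) * (s - s0) by rewrite mulr_ge0 ?subr_ge0.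
  nra.
have hQ : (a ^+ 2 * q) `^ (- (m%:R / 4)) <= (c ^+ 2 * q) `^ (- (m%:R / 4)).
  rewrite !powRN lef_pV2 ?posrE ?powR_gt0 ?mulr_gt0 ?exprn_gt0//.
  rewrite ge0_ler_powR ?nnegrE ?divr_ge0 ?mulr_ge0 ?sqr_ge0//
    ?(ltW q0) ?(ltW a0) ?(ltW c0)//.
  by rewrite ler_pM2r// lerXn2r ?nnegrE ?(ltW a0) ?(ltW c0).
set D := 2 `^ _ * pi `^ _; set Pz := \prod_i z i `^ _.
have W0 : 0 <= a ^+ m * (\prod_i g i / D * Pz).
  rewrite mulr_ge0 ?exprn_ge0 ?(ltW a0)// mulr_ge0//.
    rewrite divr_ge0 ?mulr_ge0 ?powR_ge0//.
    by apply: prodr_ge0 => i _; exact: ltW.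
  by apply: prodr_ge0 => i _; exact: powR_ge0.
have H := ler_wpM2r W0 (ler_pM (mulr_ge0 (expR_ge0 _) (besselK_ge0 _ _))
  (powR_ge0 _ _) hK hQ).
apply: le_trans (le_trans H _); rewrite le_eqVlt; apply/orP; left; apply/eqP.
  ring.
rewrite expr_div_n; field; rewrite expf_neq0 ?gt_eqF//.
by rewrite mulr_gt0 ?powR_gt0 ?pi_gt0.
Qed.

End nig_density.

(** * Tail bound for N-IG vectors *)

Lemma simplex_pointK {R : realType} (m : nat) (z : 'I_m -> R) :
  \sum_i z i = 1 ->
  simplex_point [tuple z (widen_ord (leq_pred m) i) | i < m.-1] = z.
Proof.
case: m z => [|m] z z1; apply/funext => i; first by case: i.
rewrite /simplex_point; have [im|im] := ltnP i m.
  rewrite -(tnth_nth _ _ (Ordinal im)) tnth_mktuple; congr z.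
  exact: val_inj.
rewrite nth_default ?size_tuple//.
have -> : i = ord_max by apply/val_inj/anti_leq; rewrite -ltnS ltn_ord.
apply/eqP; rewrite subr_eq -z1 big_ord_recr/= addrC; apply/eqP.
congr (_ + _); apply: eq_bigr => j _; rewrite tnth_mktuple; congr z.
exact: val_inj.
Qed.

(** The pointwise comparison of densities is integrated over the tail set. [Zc] turns the remaining
    integral of the density for c into a probability, hence a number at most 1. *)
Lemma has_NIG_tail {R : realType} d (Omega : measurableType d)
    (P : probability Omega R) (m : nat) (g : 'I_m -> R) (c a e : R)
    (Zc Za : Omega -> 'I_m -> R) (k : 'I_m) :
  (forall i, 0 < g i) -> \sum_i g i = 1 -> 0 < c -> c <= a -> 0 < e ->
  has_NIG P (fun i => c * g i) Zc -> has_NIG P (fun i => a * g i) Za ->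
  (P [set w | (e < `|Za w k - g k|)%R] <=
   ((a / c) ^+ m * expR (- ((a - c) * (Num.sqrt (1 + e ^+ 2) - 1))))%:E)%E.
Proof.
move=> g0 g1 c0 ca e0 [_ _ mZc _ fc] [_ _ mZ sZ fa].
have a0 : 0 < a := lt_le_trans c0 ca.
set K := _ * _.
have K0 : 0 <= K by rewrite mulr_ge0 ?expR_ge0// exprn_ge0// divr_ge0 ?ltW.
pose B : set (m.-1.-tuple (measurableTypeR R)) :=
  [set z | e < `|simplex_point z k - g k|].
have mB : measurable B.
  rewrite -[B]setTI; apply: (measurable_fun_ltr (f := cst e)) => //.
  apply: measurableT_comp => //; apply: measurable_funB => //.
  exact: measurable_simplex_point.
have mT (Z : Omega -> 'I_m -> R) :
    (forall i, measurable_fun setT (fun w => Z w i)) ->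
    measurable [set w | B [tuple Z w (widen_ord (leq_pred m) i) | i < m.-1]].
  move=> mZ'; rewrite -[X in measurable X]setTI.
  suff mTZ : measurable_fun setT (fun w =>
      [tuple Z w (widen_ord (leq_pred m) i) | i < m.-1]
        : m.-1.-tuple (measurableTypeR R)) by exact: mTZ.
  apply/measurable_fun_tnthP => i.
  apply: eq_measurable_fun (mZ' (widen_ord (leq_pred m) i)) => w _.
  by rewrite /= tnth_mktuple.
have mE : measurable [set w | e < `|Za w k - g k|].
  rewrite -[X in measurable X]setTI.
  apply: (measurable_fun_ltr (f := cst e)) => //.
  apply: measurableT_comp => //; apply: measurable_funB => //.
have mE' := mT _ mZ.
(* The density governs only the first m-1 coordinates, and [simplex_point] rebuilds [Za w] from them
   when it lies in the simplex; the exceptional null set [N] is added to the event. *)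
have [N [mN N0 sN]] := sZ.
pose E := [set w | B [tuple Za w (widen_ord (leq_pred m) i) | i < m.-1]].
apply: (@le_trans _ _ (P (E `|` N))).
  apply: le_measure; rewrite ?inE//; first exact: measurableU.
  move=> w Ew; have [sw|/sN] := pselect (simplex (Za w)); last by right.
  by left; rewrite /E /= /B /= simplex_pointK//; case: sw.
rewrite measureU0//; rewrite [leLHS](fa B mB).
have mf b : measurable_fun setT (fun z : m.-1.-tuple (measurableTypeR R) =>
    (nig_density (fun i => b * g i) (simplex_point z))%:E).
  by apply/measurable_EFinP; exact: measurable_nig_density.
have f0 b z : 0 < b -> (0 <= (nig_density (fun i => b * g i) z)%:E)%E.
  by move=> b0; rewrite lee_fin nig_density_ge0// => i; rewrite mulr_ge0 ?ltW.
apply: (@le_trans _ _ (\int[lebesgue_tuple R m.-1]_(z in B)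
    (K%:E * (nig_density (fun i => c * g i) (simplex_point z))%:E))%E).
  apply: ge0_le_integral => //.
  - by move=> z _; exact: f0.
  - exact: measurable_funTS.
  - by apply: measurable_funTS; exact: measurable_funeM.
  - by move=> z Bz; rewrite -EFinM lee_fin; exact: nig_density_scale_le Bz.
rewrite ge0_integralZl_EFin//; last 2 first.
  - by move=> z _; exact: f0.
  - exact: measurable_funTS.
rewrite -[leRHS]mule1 lee_wpmul2l ?lee_fin//.
by rewrite -[leLHS](fc B mB) probability_le1//; exact: mT.
Qed.

(** * Summability of the tails and Borel-Cantelli *)

Lemma geometric_eseries_lty {R : realType} (u : (\bar R)^nat) (C r : R) :
  0 <= C -> 0 <= r < 1 -> (forall n, 0 <= u n <= (C * r ^+ n)%:E)%E ->
  (\sum_(n <oo) u n < +oo)%E.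
Proof.
move=> C0 /andP[r0 r1] uC.
apply: (@le_lt_trans _ _ (\sum_(n <oo) (C * r ^+ n)%:E)%E).
  by apply: lee_nneseries => n _; have /andP[] := uC n.
have cvgg : series (geometric C r) @ \oo --> C / (1 - r).
  by apply: cvg_geometric_series; rewrite ger0_norm.
suff -> : (\sum_(n <oo) (C * r ^+ n)%:E = (C / (1 - r))%:E)%E by rewrite ltry.
apply/cvg_lim => //.
rewrite (_ : (fun n => _) = EFin \o series (geometric C r)); last first.
  by apply/funext => n /=; rewrite sumEFin.
by apply/cvg_EFin; [exact: nearW|].
Qed.

(** With t = (n+1)^2, split e^(-b t) into two halves: one absorbs the power t^m into a constant, the
    other is at most (e^(-b/2))^n since n <= t. *)
Lemma sqr_expr_expR_le_geometric {R : realType} (m : nat) (b : R) : 0 < b ->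
  exists2 C, 0 <= C & forall n : nat,
    (n.+1%:R ^+ 2) ^+ m * expR (- (b * n.+1%:R ^+ 2)) <=
    C * expR (- (b / 2)) ^+ n.
Proof.
move=> b0; have b2 : 0 < b / 2 by rewrite divr_gt0.
(* The exponent m+1 is positive even for m = 0; as t >= 1, it also bounds the power m. *)
have [|C hC] := powR_expR_bounded m.+1%:R (b / 2) _ b2; first by [].
have t1 n : 1 <= n.+1%:R ^+ 2 :> R by rewrite exprn_ege1// ler1n.
exists C => [|n].
  by apply: le_trans (hC 1 ltr01); rewrite mulr_ge0 ?powR_ge0 ?expR_ge0.
set t := n.+1%:R ^+ 2.
have t0 : 0 < t by exact: lt_le_trans (t1 n).
have nt : n%:R <= t.
  rewrite (@le_trans _ _ n.+1%:R) ?ler_nat//.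
  by rewrite /t expr2 ler_peMl// ler1n.
have -> : - (b * t) = - (b / 2 * t) + - (b / 2 * t) by field.
rewrite expRD mulrA ler_pM ?mulr_ge0 ?expR_ge0 ?exprn_ge0 ?(ltW t0)//.
  apply: le_trans (hC t t0); rewrite ler_wpM2r ?expR_ge0//.
  rewrite powR_mulrn ?(ltW t0)//.
  by rewrite exprS ler_peMl ?exprn_ge0 ?(ltW t0) ?t1.
rewrite -expRM_natl ler_expR mulrN lerN2 mulrC.
by rewrite ler_wpM2l// ltW.
Qed.

(** Borel-Cantelli is applied at each threshold 1/(j+1), and the countably many almost sure events
    are then intersected. *)
Lemma has_NIG_ae_cvg {R : realType} d (Omega : measurableType d)
    (P : probability Omega R) (m : nat) (g : 'I_m -> R) (c : R)
    (Z : nat -> Omega -> 'I_m -> R) (k : 'I_m) :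
  (forall i, 0 < g i) -> \sum_i g i = 1 -> 0 < c ->
  (forall n, (1 <= n)%N -> has_NIG P (fun i => n%:R ^+ 2 * c * g i) (Z n)) ->
  {ae P, forall w, Z n w k @[n --> \oo] --> g k}.
Proof.
move=> g0 g1 c0 hZ.
pose E (j n : nat) := [set w | j.+1%:R^-1 < `|Z n.+1 w k - g k|].
have mE j n : measurable (E j n).
  have [_ _ mZ _ _] := hZ n.+1 isT.
  rewrite -[X in measurable X]setTI.
  apply: (measurable_fun_ltr (f := cst j.+1%:R^-1)) => //.
  by apply: measurableT_comp => //; exact: measurable_funB.
have PE j : P (lim_sup_set (E j)) = 0%E.
  apply: lim_sup_set_cvg0 => //.
  set e : R := j.+1%:R^-1; have e0 : 0 < e by rewrite invr_gt0.
  (* For a = (n+1)^2 c the tail bound is (n+1)^(2m) e^(b - b (n+1)^2); the factor e^b goes into the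
     geometric constant. *)
  pose b := c * (Num.sqrt (1 + e ^+ 2) - 1).
  have b0 : 0 < b.
    rewrite mulr_gt0// subr_gt0 -{1}(sqrtr1 R).
    by rewrite ltr_sqrt ?ltrDl ?addr_gt0 ?exprn_gt0.
  have [C C0 hC] := sqr_expr_expR_le_geometric m b b0.
  apply: (@geometric_eseries_lty _ _ (expR b * C) (expR (- (b / 2)))).
  - by rewrite mulr_ge0 ?expR_ge0.
  - by rewrite expR_ge0/= expR_lt1 oppr_lt0 divr_gt0.
  move=> n; rewrite measure_ge0/=.
  have n1 : 1 <= n.+1%:R ^+ 2 :> R by rewrite exprn_ege1// ler1n.
  (* The reference vector for the tail bound is [Z 1], of concentration c. *)
  have h1 : has_NIG P (fun i => c * g i) (Z 1).
    have := hZ 1 isT; congr has_NIG; apply/funext => i.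
    by rewrite expr1n mul1r.
  apply: le_trans
    (has_NIG_tail _ _ P m g c _ e _ _ k g0 g1 c0 _ e0 h1 (hZ n.+1 isT)) _.
    by rewrite ler_peMl// ltW.
  rewrite lee_fin mulfK ?gt_eqF// -mulrA.
  have := ler_wpM2l (expR_ge0 b) (hC n); apply: le_trans.
  rewrite mulrCA -expRD le_eqVlt; apply/orP; left; apply/eqP.
  by congr (_ * expR _); rewrite /b; ring.
have : {ae P, forall w, forall j, ~ lim_sup_set (E j) w}.
  apply: ae_foralln => j; exists (lim_sup_set (E j)); split; [|exact: PE|].
    by apply: bigcap_measurable => // i _; exact: bigcup_measurable.
  by move=> w /= /contrapT.
apply: filterS => w hw.
rewrite -(cvg_shiftS (fun n => Z n w k)); apply/cvgrPdist_lt => e e0.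
have [j je] : exists j : nat, j.+1%:R^-1 < e.
  by have [j _ /(_ j (leqnn _))] := near_infty_natSinv_lt (PosNum e0); exists j.
(* Outside the limsup of [E j] there is a rank [n0] from which no [E j n] occurs. *)
have /existsNP[n0 hn0] := hw j; exists n0 => // n /= n0n.
rewrite distrC; apply: le_lt_trans je; rewrite leNgt; apply/negP => En.
by apply: hn0 => _; exists n.
Qed.

(** * Kernels on the partition into a set and its complement *)

Definition split_by {T : Type} (A : set T) (i : 'I_2) : set T :=
  if i == ord0 then A else ~` A.

(** [partition] demands nonempty cells, so empty sets have to be treated apart wherever this is
    used. *)
Lemma partition_split_by {T : Type} (A : set T) :
  A !=set0 -> ~` A !=set0 -> partition setT (split_by A) setT.
Proof.
move=> A0 cA0; split.
- apply/seteqP; split => // x _; have [Ax|nAx] := pselect (A x).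
    by exists ord0.
  by exists ord_max.
- move=> [[|[|//]] i2] [[|[|//]] j2] _ _ [x []] /=; rewrite /split_by/=.
  + by move=> _ _; exact: val_inj.
  + by [].
  + by [].
  + by move=> _ _; exact: val_inj.
- by move=> i _; rewrite /split_by; case: ifP.
Qed.

Lemma measurable_split_by d (T : measurableType d) (A : set T) i :
  measurable A -> measurable (split_by A i).
Proof.
by move=> mA; rewrite /split_by; case: ifP => // _; exact: measurableC.
Qed.

Lemma pker_fin_num {R : realType} d d' (X : measurableType d)
    (Y : measurableType d') (Q : R.-pker X ~> Y) x (A : set Y) :
  measurable A -> Q x A \is a fin_num.
Proof.
move=> mA; rewrite ge0_fin_numE ?measure_ge0//; apply: le_lt_trans (ltry 1).
by rewrite -(prob_kernel (s := Q) x) le_measure ?inE.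
Qed.

Lemma pker_setC {R : realType} d d' (X : measurableType d)
    (Y : measurableType d') (Q : R.-pker X ~> Y) x (A : set Y) :
  measurable A -> (Q x (~` A) = 1 - Q x A)%E.
Proof.
move=> mA; have QT := prob_kernel (s := Q) x.
rewrite -QT -(setUv A) measureU ?setICr//; last exact: measurableC.
by rewrite addeAC subee ?add0e// pker_fin_num.
Qed.

Lemma is_NIGP_null {R : realType} dO (Omega : measurableType dO)
    (P : probability Omega R) dX (X : measurableType dX) (a : R)
    (H : probability X R) (Q : R.-pker Omega ~> X) (A : set X) :
  is_NIGP P a H Q -> measurable A -> H A = 0%E ->
  {ae P, forall w, Q w A = 0%E}.
Proof.
move=> PQ mA HA.
have [->|/set0P A0] := eqVneq A set0.
  by apply: nearW => w; rewrite measure0.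
(* The complement has [H]-probability 1, so it cannot be empty. *)
have cA0 : ~` A !=set0.
  apply/set0P/eqP => cA; have /eqP := probability_setC H mA.
  by rewrite cA HA sube0 measure0 eq_sym onee_eq0.
have [/(_ ord0) h _] := PQ 2 _ (fun i => measurable_split_by _ _ _ i mA)
  (partition_split_by A A0 cA0).
by apply: h; rewrite inE /= HA eqxx.
Qed.

(** * Almost sure convergence on a measurable set *)

Theorem theorem2 (R : realType)
    (dX : measure_display) (X : measurableType dX) (H : probability X R)
    (c : R) (c_gt0 : 0 < c)
    (dO : measure_display) (Omega : measurableType dO)
    (P : probability Omega R)
    (PH : nat -> R.-pker Omega ~> X)
    (PH_NIGP : forall n : nat, (1 <= n)%N ->
      is_NIGP P (n%:R ^+ 2 * c) H (PH n))
    (A : set X) (mA : measurable A) :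
  {ae P, forall w, PH n w A @[n --> \oo] --> H A}.
Proof.
have null B : measurable B -> H B = 0%E ->
    {ae P, forall w, forall n, PH n.+1 w B = 0%E}.
  move=> mB HB; apply: ae_foralln => n.
  exact: is_NIGP_null (PH_NIGP n.+1 isT) mB HB.
have cvgS (w : Omega) : (forall n, PH n.+1 w A = H A) ->
    PH n w A @[n --> \oo] --> H A.
  move=> h; rewrite -(cvg_shiftS (fun n => PH n w A)).
  by rewrite (_ : (fun n => _) = cst (H A)); [exact: cvg_cst|exact/funext].
(* If [H A] is 0 or 1, the sequence is almost surely constant from rank 1 on; otherwise the two-cell
   partition has a genuine N-IG law. *)
have [HA0|HA0] := eqVneq (H A) 0%E.
  by apply: filterS (null _ mA HA0) => w h; apply: cvgS => n; rewrite h.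
have mAC := measurableC mA.
have [HC0|HC0] := eqVneq (H (~` A)) 0%E.
  apply: filterS (null _ mAC HC0) => w h; apply: cvgS => n.
  have := probability_setC H mAC; rewrite setCK HC0 => ->.
  by have := pker_setC _ _ _ _ (PH n.+1) w _ mAC; rewrite setCK h.
have A0 : A !=set0.
  by apply/set0P; apply: contra_neq HA0 => ->; rewrite measure0.
have cA0 : ~` A !=set0.
  by apply/set0P; apply: contra_neq HC0 => ->; rewrite measure0.
pose F := split_by A.
have mF i : measurable (F i) by exact: measurable_split_by.
pose J := [pred i : 'I_2 | H (F i) != 0%E].
have HF i : H (F i) != 0%E by rewrite /F /split_by; case: ifP.
have JT : J =i predT by move=> i; rewrite !inE HF.
have J2 : (2 <= #|J|)%N by rewrite (eq_card JT) card_ord.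
(* The N-IG vector is indexed by the enumeration of the non-null cells, here both of them; [k] is
   the position of [A]. *)
pose k : 'I_#|J| := enum_rank_in (HF ord0 : ord0 \in J) ord0.
have kE : enum_val k = ord0 by rewrite enum_rankK_in// HF.
pose g (i : 'I_#|J|) : R := fine (H (F (enum_val i))).
have g0 i : 0 < g i.
  by rewrite fine_gt0// lt0e HF measure_ge0/= ltey_eq fin_num_measure.
have g1 : \sum_i g i = 1.
  rewrite -(big_enum_val (A := J) (fun i => fine (H (F i)))) (eq_bigl _ _ JT).
  rewrite big_ord_recl big_ord1 /F /split_by/= probability_setC//.
  by rewrite fineB ?fin_num_measure//= addrC subrK.
have := has_NIG_ae_cvg _ _ P _ g c
  (fun n w i => fine (PH n w (F (enum_val i)))) k g0 g1 c_gt0.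
have : forall n : nat, (1 <= n)%N -> has_NIG P
    (fun i => n%:R ^+ 2 * c * g i) (fun w i => fine (PH n w (F (enum_val i)))).
  move=> n n1; have [_] := PH_NIGP n n1 2 _ mF (partition_split_by A A0 cA0).
  exact.
move=> h /(_ h); apply: filterS => w; rewrite /g kE /F /split_by /=.
(* The convergence obtained is that of real parts; it lifts to the extended reals because all values
   are finite. *)
rewrite -[in X in _ -> X](fineK (fin_num_measure H _ mA)) => cvgA.
by apply: cvg_EFin cvgA; apply: nearW => n; exact: pker_fin_num.
Qed.
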